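(* For any odd prime $p$, any integer $\alpha\ge0$ and any integer $n\ge0$, \[ b_4\!\left(p^{2\alpha+1}n+\frac{(8j+1)p^{2\alpha}-1}{8}\right)\equiv 0 \pmod 2 \] for every integer $j$ with $0\le j\le p-1$ and $\left(\frac{8j+1}{p}\right)=-1$.
   Context: For a positive integer $\ell$, $b_\ell(n)$ denotes the number of partitions of $n$ having no part divisible by $\ell$. $\left(\frac{a}{p}\right)$ is the Legendre symbol. *)

(* Defs.v *)
From mathcomp Require Import all_boot all_order all_algebra.
Set Implicit Arguments. Unset Strict Implicit. Unset Printing Implicit Defensive.

(* A partition of n is encoded as a nonincreasing n-tuple of naturals in
   [0, n] summing to n; the nonzero entries are the parts, the zero entries
   are padding (a partition of n has at most n parts, each at most n).
   This is a bijective encoding of the usual partitions of n. *)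
Definition is_partition (n : nat) (t : n.-tuple 'I_n.+1) : bool :=
  sorted geq (map val t) && (sumn (map val t) == n).

Definition b (l n : nat) : nat :=
  #|[set t : n.-tuple 'I_n.+1 | is_partition t &&
        all (fun x : 'I_n.+1 => (val x == 0) || ~~ (l %| val x)) t]|.

Definition legendre (a p : nat) : int :=
  if p %| a then 0%Z
  else if [exists x : 'I_p, (x * x) %% p == a %% p] then 1%Z else (-1)%Z.

(* Main.v *)
(* Over F_2 put E = prod_(k > 0) (1 - X^k).  The generating function of b_4 is
   prod (1 - X^(4k)) / (1 - X^k) = E^4 / E = E^3, and Gauss's identity
   prod (1 - X^k) (1 + X^k)^2 = sum_(j >= 0) X^(j(j+1)/2) shows that b_4(N) is odd
   only if N is triangular, i.e. 8N + 1 is a square.  For the N of the theorem,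
   8N + 1 = p^(2 alpha) (8pn + 8j + 1), which would make 8j + 1 a square mod p.
   All power series are replaced by polynomials modulo X^(N+1), and Gauss's
   identity by its finite form, a case of the q-binomial theorem. *)

Require Import Defs.
From mathcomp Require Import all_boot all_order all_algebra.
From mathcomp Require Import ring zify.
Set Implicit Arguments. Unset Strict Implicit. Unset Printing Implicit Defensive.
Import GRing.Theory.

(** * Gaussian binomials and the finite form of Gauss's identity *)

Section GaussBinomial.
Local Open Scope ring_scope.
Variable R : comNzRingType.

Definition qfact (m : nat) : {poly R} := \prod_(i < m) (1 - 'X^(i.+1)).

(** The q-binomial coefficient at q = X, given by Pascal's recurrence so that it is a polynomial
    over any ring, without division. *)
Fixpoint gauss (n k : nat) : {poly R} :=
  match n, k with
  | _, 0%N => 1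
  | 0%N, _.+1 => 0
  | n'.+1, k'.+1 => gauss n' k' + 'X^(k'.+1) * gauss n' k'.+1
  end.

Lemma gaussn0 n : gauss n 0 = 1. Proof. by case: n. Qed.

Lemma gaussS n k : gauss n.+1 k.+1 = gauss n k + 'X^(k.+1) * gauss n k.+1.
Proof. by []. Qed.

Lemma gauss_small n k : (n < k)%N -> gauss n k = 0.
Proof.
elim: n k => [|n IHn] [|k] //= ltnk.
by rewrite !IHn ?mulr0 ?addr0 // ltnW.
Qed.

Lemma qfactS m : qfact m.+1 = qfact m * (1 - 'X^(m.+1)).
Proof. by rewrite /qfact big_ord_recr. Qed.

(** Induction on the recurrence; its two terms combine through (1 - X^(k+1)) + X^(k+1) (1 - X^(n-k))
    = 1 - X^(n+1). *)
Lemma gauss_qfact n k :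
  (k <= n)%N -> gauss n k * qfact k * qfact (n - k) = qfact n.
Proof.
elim: n k => [|n IHn] [|k] //=; rewrite ?subn0 ?mul1r /qfact ?big_ord0 ?mul1r //.
rewrite -!/(qfact _) ltnS subSS leq_eqVlt => /predU1P[->|ltkn].
  rewrite (gauss_small (ltnSn n)) mulr0 addr0 !qfactS.
  by rewrite -[in RHS](IHn n) // subnn; ring.
have En : (n - k = (n - k.+1).+1)%N by lia.
have H1 := IHn k (ltnW ltkn); have H2 := IHn k.+1 ltkn.
have -> : (gauss n k + 'X^(k.+1) * gauss n k.+1) * qfact k.+1 * qfact (n - k)
  = gauss n k * qfact k * qfact (n - k) * (1 - 'X^(k.+1))
    + 'X^(k.+1) * (1 - 'X^(n - k)) *
       (gauss n k.+1 * qfact k.+1 * qfact (n - k.+1)).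
  by rewrite En !qfactS; ring.
rewrite H1 H2 qfactS.
have -> : 'X^(n.+1) = 'X^(k.+1) * 'X^(n - k) :> {poly R}.
  by rewrite -exprD; congr ('X^_); lia.
by ring.
Qed.

(** Induction on N: splitting off the factor i = 0 replaces z by zX in the rest, and Pascal's
    recurrence recombines the coefficients. *)
Lemma gauss_binomial N (y z : {poly R}) :
  \prod_(i < N) (y + z * 'X^i) =
  \sum_(k < N.+1) gauss N k * 'X^'C(k, 2) * z ^+ k * y ^+ (N - k).
Proof.
elim: N z => [|N IHN] z.
  by rewrite big_ord0 big_ord1 /= !mulr1.
rewrite big_ord_recl expr0 mulr1.
under eq_bigr => i _ do rewrite /= /bump /= add1n exprS mulrA.
rewrite IHN mulrDl [in RHS]big_ord_recl.
have -> : y * (\sum_(k < N.+1) gauss N k * 'X^'C(k, 2) * (z * 'X) ^+ k * y ^+ (N - k))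
    = y ^+ N.+1 + \sum_(k < N.+1)
        'X^(k.+1) * gauss N k.+1 * 'X^'C(k.+1, 2) * z ^+ k.+1 * y ^+ (N - k).
  rewrite big_ord_recl big_ord_recr /= (gauss_small (ltnSn N)) mulr0 !mul0r addr0 gaussn0.
  rewrite !expr0 !mul1r subn0 mulrDr -exprS mulr_sumr; congr (_ + _).
  apply: eq_bigr => i _; rewrite /bump /= add1n.
  have -> : (N - i = (N - i.+1).+1)%N by have := ltn_ord i; lia.
  by rewrite exprMn [y ^+ _.+1]exprS; ring.
rewrite -addrA; congr (_ + _).
  by rewrite /= bin_small // !expr0 !mul1r subn0.
rewrite mulr_sumr -big_split; apply: eq_bigr => i _ /=.
rewrite /bump /= add1n subSS add0n binS bin1 exprMn [z ^+ _.+1]exprS exprD; ring.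
Qed.

End GaussBinomial.

Arguments gauss : simpl never.

Section FiniteTripleProduct.
Local Open Scope ring_scope.

Lemma prodr_X (R : comNzRingType) (I : Type) (r : seq I) (e : I -> nat) :
  \prod_(i <- r) 'X^(e i) = 'X^(\sum_(i <- r) e i) :> {poly R}.
Proof. by rewrite (big_morph _ (exprD 'X) (expr0 'X)). Qed.

(** The factorial formula is symmetric in k and n - k, and [qfact] has value 1 at 0, so it is
    nonzero and cancels in a domain. *)
Lemma gauss_sym (R : idomainType) n k :
  (k <= n)%N -> gauss R n (n - k) = gauss R n k.
Proof.
move=> lekn; have qn0 m : qfact R m != 0.
  apply/eqP => /(congr1 (horner^~ 0)); rewrite horner0 /qfact horner_prod.
  rewrite big1 => [/eqP|i _]; first by rewrite oner_eq0.
  by rewrite !hornerE expr0n subr0.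
apply: (mulIf (qn0 k)); apply: (mulIf (qn0 (n - k)%N)).
rewrite gauss_qfact // -[RHS](@gauss_qfact _ n (n - k)) ?leq_subr // subKn //.
by rewrite mulrAC.
Qed.

Lemma bin2D m k : 'C(m + k, 2) = ('C(m, 2) + m * k + 'C(k, 2))%N.
Proof.
elim: k => [|k IHk]; first by rewrite !addn0 muln0 addn0.
by rewrite addnS !binS IHk !bin1; lia.
Qed.

Lemma bin2_sqr k : ('C(k, 2) + 'C(k, 2) + k = k * k)%N.
Proof. by elim: k => // k IHk; rewrite binS bin1; lia. Qed.

(* The q-binomial theorem with N = 2m+1, y = X^m, z = 1: the terms k = m - j and
   k = m + 1 + j coincide, and the factor i = m of the product is 2 X^m.  This
   factor 2 is why the identity is first proved over int: it cancels there, but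
   not in characteristic 2. *)
Lemma finite_gauss_int m :
  \prod_(i < m) (1 + 'X^(i.+1)) ^+ 2 =
  \sum_(j < m.+1) gauss int (2 * m).+1 (m - j) * 'X^'C(j.+1, 2).
Proof.
(* The power of X common to both sides: C(m,2) from the factors i < m, m from i = m, and m * m from
   the factors i > m. *)
pose e := ('C(m, 2) + m + m * m)%N.
have := gauss_binomial (2 * m).+1 ('X^m : {poly int}) 1.
have -> : \prod_(i < (2 * m).+1) ('X^m + 1 * 'X^i) =
    2%:R * 'X^e * \prod_(i < m) (1 + 'X^(i.+1)) ^+ 2 :> {poly int}.
  rewrite (_ : (2 * m).+1 = m + m.+1)%N; last by lia.
  rewrite big_split_ord big_ord_recl /= addn0 mul1r.
  have -> : \prod_(i < m) ('X^m + 1 * 'X^i) =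
      'X^('C(m, 2)) * \prod_(i < m) (1 + 'X^(i.+1)) :> {poly int}.
    rewrite -bin2_sum big_mkord -prodr_X (reindex_inj rev_ord_inj) /=.
    rewrite [in X in X * _](reindex_inj rev_ord_inj) /= -big_split /=.
    apply: eq_bigr => i _; rewrite mul1r mulrDr mulr1 addrC -exprD.
    by congr (_ + 'X^_); have := ltn_ord i; lia.
  have -> : \prod_(i < m) ('X^m + 1 * 'X^(m + bump 0 i)) =
      'X^(m * m) * \prod_(i < m) (1 + 'X^(i.+1)) :> {poly int}.
    rewrite exprM -[in X in X * _](card_ord m) -prodr_const -big_split /=.
    rewrite card_ord; apply: eq_bigr => i _.
    by rewrite mul1r /bump /= add1n exprD mulrDr mulr1.
  under [in RHS]eq_bigr => i _ do rewrite expr2.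
  by rewrite big_split /= /e !exprD; ring.
have -> : \sum_(k < (2 * m).+2) gauss int (2 * m).+1 k * 'X^'C(k, 2) * 1 ^+ k *
     'X^m ^+ ((2 * m).+1 - k) =
    2%:R * 'X^e * \sum_(j < m.+1) gauss int (2 * m).+1 (m - j) * 'X^'C(j.+1, 2).
  rewrite -mulrA mulr_natl mulr2n.
  rewrite (_ : (2 * m).+2 = m.+1 + m.+1)%N; last by lia.
  rewrite big_split_ord /=; congr (_ + _).
    rewrite -[LHS](big_mkord xpredT (fun k => gauss int (2 * m).+1 k *
      'X^'C(k, 2) * 1 ^+ k * 'X^m ^+ ((2 * m).+1 - k))).
    rewrite big_nat_rev /= big_mkord mulr_sumr; apply: eq_bigr => j _.
    have lejm : (j <= m)%N by rewrite -ltnS.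
    rewrite add0n subSS expr1n mulr1 mulrCA -mulrA; congr (_ * _).
    rewrite -!exprM -!exprD; congr 'X^_.
    rewrite /e binS bin1; move: (nat_of_ord j) lejm => k lekm.
    by have := bin2D (m - k) k; have := bin2_sqr k; rewrite subnK //; nia.
  rewrite mulr_sumr; apply: eq_bigr => j _.
  have lejm : (j <= m)%N by rewrite -ltnS.
  rewrite expr1n mulr1 mulrCA -mulrA -gauss_sym; last by lia.
  rewrite (_ : (2 * m).+1 - (m.+1 + j) = m - j)%N; last by lia.
  congr (_ * _); rewrite -!exprM -!exprD; congr 'X^_.
  rewrite /e addSnnS bin2D.
  by have := subnK lejm; set d := (m - j)%N; nia.
apply: mulfI; apply: mulf_neq0; last exact: monic_neq0 (monicXn _ _).
by rewrite -[2%:R]polyC_natr polyC_eq0.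
Qed.

Lemma map_gauss (R S : comNzRingType) (f : {rmorphism R -> S}) n k :
  map_poly f (gauss R n k) = gauss S n k.
Proof.
elim: n k => [|n IHn] [|k]; rewrite ?gaussn0 ?rmorph1 ?rmorph0 //.
by rewrite !gaussS rmorphD rmorphM /= map_polyXn !IHn.
Qed.

Lemma finite_gauss (R : comNzRingType) m :
  \prod_(i < m) (1 + 'X^(i.+1)) ^+ 2 =
  \sum_(j < m.+1) gauss R (2 * m).+1 (m - j) * 'X^'C(j.+1, 2).
Proof.
have := congr1 (map_poly (intr : int -> R)) (finite_gauss_int m).
rewrite rmorph_prod rmorph_sum /=.
under eq_bigr => i _ do rewrite rmorphXn rmorphD rmorph1 /= map_polyXn.
under [X in _ = X]eq_bigr => i _ do rewrite rmorphM /= map_polyXn map_gauss.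
by [].
Qed.

End FiniteTripleProduct.

(** * Partitions as multiplicity functions *)

(** The common size forces the multiplicity of the one value [x0] left out. It serves with [x0] = 0,
    the padding entry that [part_mult] does not record. *)
Lemma perm_count_mem_neq (T : eqType) (x0 : T) (s t : seq T) :
  size s = size t -> (forall x, x != x0 -> count_mem x s = count_mem x t) ->
  perm_eq s t.
Proof.
move=> szst cst; apply/allP => x _; apply/eqP.
have [->|] := eqVneq x x0; last exact: cst.
have : perm_eq (filter (predC1 x0) s) (filter (predC1 x0) t).
  apply/allP => y _; rewrite /= !count_filter; apply/eqP.
  have [->|neq] := eqVneq y x0.
    have E : predI (pred1 x0) (predC1 x0) =1 pred0 by move=> z /=; case: eqP.
    by rewrite !(eq_count E) !count_pred0.
  have E : predI (pred1 y) (predC1 x0) =1 pred1 y.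
    by move=> z /=; case: eqP => // ->.
  by rewrite !(eq_count E) cst.
move/perm_size; rewrite !size_filter.
have := count_predC (pred1 x0) s; have := count_predC (pred1 x0) t.
by rewrite szst => <- /eqP + E; rewrite E eqn_add2r => /eqP.
Qed.

Section Partitions.
Variables l n : nat.

(** Entry i holds the multiplicity of the part i + 1. A multiplicity is at most n, so [inord] never
    falls back to its default. *)
Definition part_mult (t : n.-tuple 'I_n.+1) : {ffun 'I_n -> 'I_n.+1} :=
  [ffun i : 'I_n => inord (count_mem i.+1 (map val t))].

Definition mult_set : {set {ffun 'I_n -> 'I_n.+1}} :=
  [set f : {ffun 'I_n -> 'I_n.+1} | (\sum_(i < n) i.+1 * f i == n) &&
    [forall i : 'I_n, (l %| i.+1) ==> (f i == 0 :> nat)]].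

Lemma part_multE t (i : 'I_n) : part_mult t i = count_mem i.+1 (map val t) :> nat.
Proof.
rewrite ffunE inordK // ltnS.
by apply: leq_trans (count_size _ _) _; rewrite size_map size_tuple.
Qed.

Lemma sumn_count_mem (s : seq nat) :
  all (fun x => x <= n) s -> \sum_(i < n) i.+1 * count_mem i.+1 s = sumn s.
Proof.
elim: s => [_|x s IHs /= /andP[lexn les]].
  by rewrite big1 // => i _; rewrite muln0.
rewrite -IHs //; under eq_bigr => i _ do rewrite mulnDr.
rewrite big_split /=; congr (_ + _); case: x lexn => [|x] ltxn.
  by rewrite big1 // => i _; rewrite muln0.
rewrite (bigD1 (Ordinal ltxn)) //= eqxx muln1 big1 ?addn0 // => i neq.
suff /negPf-> : x.+1 != i.+1 by rewrite muln0.
by apply: contraNneq neq => -[eq_xi]; apply/eqP/val_inj; rewrite /= eq_xi.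
Qed.

Lemma all_val_le (t : n.-tuple 'I_n.+1) : all (fun x => x <= n) (map val t).
Proof. by apply/allP => _ /mapP[x _ ->]; exact: (ltn_ord x). Qed.

Lemma part_mult_inj :
  {in [pred t | is_partition t] &, injective part_mult}.
Proof.
move=> t u /andP[st _] /andP[su _] Etu; apply/val_inj/(inj_map val_inj).
apply: (sorted_eq (leT := geq)) st su _ => [y x z /= lxy lzy|x y /= /andP[]|].
- exact: leq_trans lzy lxy.
- by move=> lyx lxy; apply/eqP; rewrite eqn_leq lyx lxy.
apply: (@perm_count_mem_neq _ 0); first by rewrite !size_map !size_tuple.
case=> // x _; case: (ltnP x n) => [ltxn|lenx].
  by rewrite -!(part_multE _ (Ordinal ltxn)) Etu.
have cx0 (v : n.-tuple 'I_n.+1) : count_mem x.+1 (map val v) = 0.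
  by apply/count_memPn/negP => /(allP (all_val_le v)); rewrite leqNgt ltnS lenx.
by rewrite !cx0.
Qed.

(** [part_mult] maps the partitions counted by [b] bijectively onto [mult_set]; a preimage of f is
    built by listing f i copies of each part i + 1, padding with zeros and sorting. *)
Lemma b_card : b l n = #|mult_set|.
Proof.
rewrite /b -(card_in_imset (f := part_mult)); last first.
  move=> t u; rewrite !inE => /andP[pt _] /andP[pu _].
  by apply: part_mult_inj; rewrite inE.
congr #|pred_of_set _|; apply/setP => f; apply/imsetP/idP => [[t]|].
  rewrite !inE => /andP[/andP[_ /eqP st] /allP lt] ->; apply/andP; split.
    under eq_bigr => i _ do rewrite part_multE.
    by rewrite sumn_count_mem ?all_val_le // st.
  apply/forallP => i; apply/implyP => li; rewrite part_multE.
  apply/eqP/count_memPn/negP => /mapP[x /lt + E].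
  by rewrite -E /= li.
rewrite inE => /andP[/eqP sf /forallP lf].
pose s0 := flatten [seq nseq (f i) i.+1 | i <- enum 'I_n].
have c0 (i : 'I_n) : count_mem i.+1 s0 = f i.
  rewrite count_flatten -map_comp sumnE big_map big_enum /= (bigD1 i) //=.
  rewrite count_nseq /= eqxx mul1n big1 ?addn0 // => k neq.
  by rewrite count_nseq /= eqSS val_eqE (negPf neq).
have m0 x : x \in s0 -> exists2 i : 'I_n, x = i.+1 & f i != 0 :> nat.
  case/flattenP => _ /mapP[i _ ->] /nseqP[-> fi]; exists i => //.
  by rewrite -lt0n.
(* Every part is at least 1, so there are at most n of them and the padding length [n - size s0] is
   not truncated. *)
have sz0 : size s0 <= n.
  rewrite size_flatten /shape -map_comp sumnE big_map big_enum /= -[leqRHS]sf.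
  by apply: leq_sum => i _; rewrite size_nseq leq_pmull.
pose s := sort geq (s0 ++ nseq (n - size s0) 0).
have ps : perm_eq s (s0 ++ nseq (n - size s0) 0) by rewrite /s perm_sort.
have szs : size s == n by rewrite (perm_size ps) size_cat size_nseq subnKC.
have les : all (fun x => x <= n) s.
  rewrite (perm_all _ ps) all_cat; apply/andP; split.
    by apply/allP => x /m0[i -> _].
  by apply/allP => x /nseqP[->].
have szt : size (map (@inord n) s) == n by rewrite size_map.
have vt : map val (Tuple szt) = s.
  rewrite /= -map_comp -[RHS]map_id; apply/eq_in_map => x /(allP les) lx /=.
  by rewrite inordK.
have cs (i : 'I_n) : count_mem i.+1 s = f i.
  rewrite (permP ps) count_cat c0 count_nseq /= mul0n addn0 //.
exists (Tuple szt).
  rewrite inE /is_partition vt sort_sorted /=; last by move=> x y; exact: leq_total.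
  apply/andP; split.
    apply/eqP; rewrite -(sumn_count_mem les) -[RHS]sf.
    by apply: eq_bigr => i _; rewrite cs.
  apply/allP => x /(map_f val); rewrite vt (perm_mem ps) mem_cat.
  case/orP => [/m0[i -> fi]|/nseqP[-> //]].
  by apply/orP; right; apply: contra fi => li; apply: (implyP (lf i)).
apply/ffunP => i; apply: val_inj.
by rewrite /= part_multE vt cs.
Qed.

End Partitions.

(** * Generating functions modulo powers of X *)

Section CongruenceModXn.
Local Open Scope ring_scope.
Variable F : fieldType.

(** Congruence modulo X^N, in place of equality of power series. *)
Definition eqX (N : nat) (p q : {poly F}) : bool := 'X^N %| p - q.

Lemma eqX_refl N p : eqX N p p.
Proof. by rewrite /eqX subrr dvdp0. Qed.

Lemma eqX_sym N p q : eqX N p q -> eqX N q p.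
Proof. by rewrite /eqX -opprB dvdpNr. Qed.

Lemma eqX_trans N q p r : eqX N p q -> eqX N q r -> eqX N p r.
Proof.
move=> pq qr; rewrite /eqX (_ : p - r = (p - q) + (q - r)); last by ring.
exact: dvdp_add.
Qed.

Lemma eqX_mul N p q p' q' : eqX N p q -> eqX N p' q' -> eqX N (p * p') (q * q').
Proof.
move=> pq pq'; rewrite /eqX.
have -> : p * p' - q * q' = (p - q) * p' + q * (p' - q') by ring.
by apply: dvdp_add; [exact: dvdp_mulr | exact: dvdp_mull].
Qed.

Lemma eqX_sum N (I : Type) (r : seq I) (f g : I -> {poly F}) :
  (forall i, eqX N (f i) (g i)) -> eqX N (\sum_(i <- r) f i) (\sum_(i <- r) g i).
Proof.
move=> fg; apply: (big_ind2 (eqX N)) => // [|p q p' q' pq pq'].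
  exact: eqX_refl.
by rewrite /eqX opprD addrACA; apply: dvdp_add.
Qed.

Lemma eqX_prod N (I : Type) (r : seq I) (P : pred I) (f g : I -> {poly F}) :
  (forall i, P i -> eqX N (f i) (g i)) ->
  eqX N (\prod_(i <- r | P i) f i) (\prod_(i <- r | P i) g i).
Proof.
move=> fg; apply: (big_ind2 (eqX N)) => //; [exact: eqX_refl | exact: eqX_mul].
Qed.

Lemma eqX_leq M N p q : (M <= N)%N -> eqX N p q -> eqX M p q.
Proof. by move=> leMN; apply/dvdp_trans/dvdp_exp2l. Qed.

Lemma eqX_mulX M N p q : eqX N p q -> eqX (M + N) ('X^M * p) ('X^M * q).
Proof. by move=> pq; rewrite /eqX -mulrBr exprD; apply: dvdp_mul. Qed.

Lemma eqX_coef N p q i : eqX N p q -> (i < N)%N -> p`_i = q`_i.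
Proof.
case/dvdpP=> r Er ltiN; rewrite -[p](subrK q) Er coefD coefMXn ltiN.
by rewrite add0r.
Qed.

Lemma eqX_1subXn N k : (N <= k)%N -> eqX N (1 - 'X^k) 1.
Proof. by move=> leNk; rewrite /eqX addrAC subrr sub0r dvdpNr dvdp_exp2l. Qed.

Lemma eqX_prod_tail N (f : nat -> {poly F}) a b :
  (a <= b)%N -> (forall i, (a <= i)%N -> eqX N (f i) 1) ->
  eqX N (\prod_(i < b) f i) (\prod_(i < a) f i).
Proof.
move=> leab f1; rewrite -(subnKC leab); elim: (b - a)%N => [|d IHd].
  by rewrite addn0 eqX_refl.
rewrite addnS big_ord_recr /= -[X in eqX N _ X]mulr1.
by apply: eqX_mul => //; rewrite f1 ?leq_addr.
Qed.

Lemma eqX_qfact a b : (a <= b)%N -> eqX a.+1 (qfact F b) (qfact F a).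
Proof.
move=> leab; apply: (@eqX_prod_tail _ (fun i => 1 - 'X^(i.+1))) => // i leai.
exact: eqX_1subXn.
Qed.

(* [qfact] has constant term 1, so it is coprime to 'X^N. *)
Lemma eqX_qfactI N m p q : eqX N (qfact F m * p) (qfact F m * q) -> eqX N p q.
Proof.
rewrite /eqX -mulrBr Gauss_dvdpr // coprimep_expl // coprimep_sym coprimepX.
rewrite /root /qfact horner_prod big1 ?oner_eq0 // => i _.
by rewrite !hornerE expr0n subr0.
Qed.

(** The Gaussian binomial is qfact(2m+1) / (qfact(m-j) qfact(m+j+1)). Modulo X^(m-j+1) each of these
    factors, and [qfact F m], agrees with qfact(m-j), so everything cancels. *)
Lemma eqX_qfact_gauss m j : (j <= m)%N ->
  eqX (m - j).+1 (qfact F m * gauss F (2 * m).+1 (m - j)) 1.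
Proof.
move=> lejm; set g := gauss _ _ _.
apply: (@eqX_trans _ (qfact F (m - j) * g)).
  by apply: eqX_mul; rewrite ?eqX_refl // eqX_qfact ?leq_subr.
apply: (@eqX_qfactI _ (m + j).+1); rewrite mulr1 mulrC [_ * g]mulrC.
have -> : (m + j).+1 = ((2 * m).+1 - (m - j))%N by lia.
rewrite gauss_qfact; last by lia.
by apply: eqX_leq (eqX_qfact _); lia.
Qed.

Lemma eqX_gauss_triangular m :
  eqX m.+1 (qfact F m * \prod_(i < m) (1 + 'X^(i.+1)) ^+ 2)
           (\sum_(j < m.+1) 'X^'C(j.+1, 2)).
Proof.
rewrite finite_gauss mulr_sumr; apply: eqX_sum => j.
have lejm : (j <= m)%N by rewrite -ltnS.
rewrite mulrA mulrC -[X in eqX _ _ X]mulr1.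
(* The factor X^C(j+1,2) makes up for the lost precision: since C(j+1,2) >= j, the exponent m - j +
   1 rises to at least m + 1. *)
apply: eqX_leq (eqX_mulX _ (eqX_qfact_gauss lejm)).
by rewrite binS bin1; lia.
Qed.

Lemma prod_dvd (l n : nat) (f : nat -> {poly F}) : (0 < l)%N ->
  \prod_(i < n | (l %| i.+1)%N) f i.+1 = \prod_(i < n %/ l) f (l * i.+1)%N.
Proof.
move=> l0; elim: n => [|n IHn]; first by rewrite div0n !big_ord0.
rewrite big_mkcond big_ord_recr -big_mkcond /= IHn divnS //.
case: ifP => ln; last by rewrite mulr1.
rewrite add1n big_ord_recr /=; congr (_ * f _).
by rewrite -[LHS](divnK ln) divnS // ln add1n mulnC.
Qed.

(** The factors with l(i+1) > n are 1 to this precision; the others are those of the right side. *)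
Lemma eqX_prod_dvd (l n : nat) : (0 < l)%N ->
  eqX n.+1 (\prod_(i < n) (1 - 'X^(l * i.+1)))
           (\prod_(i < n | (l %| i.+1)%N) (1 - 'X^(i.+1))).
Proof.
move=> l0; rewrite (@prod_dvd l n (fun k => 1 - 'X^k)) //.
apply: (@eqX_prod_tail _ (fun i => 1 - 'X^(l * i.+1))); first exact: leq_div.
by move=> i lei; apply: eqX_1subXn; rewrite mulnC -ltn_divLR.
Qed.

(** Expanding the product chooses a multiplicity e for each part i + 1, with e = 0 forced on
    multiples of l; the coefficient of X^n counts the choices of weight n. *)
Lemma coef_mult_set (l n : nat) :
  (\prod_(i < n) \sum_(e < n.+1 | (l %| i.+1)%N ==> (e == 0 :> nat))
      'X^(i.+1 * e) : {poly F})`_n = #|mult_set l n|%:R.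
Proof.
rewrite bigA_distr_big_dep coef_sum.
under eq_bigr => f _ do rewrite prodr_X coefXn.
rewrite -sum1_card natr_sum [LHS]big_mkcond [RHS]big_mkcond.
apply: eq_bigr => f _; rewrite [f \in mult_set l n]inE andbC eq_sym.
set A := f \in family _; set B := [forall _, _].
have -> : A = B by apply/familyP/forallP => H i; have := H i.
by case: B; case: eqP.
Qed.

Lemma eqX_geometric (n k : nat) : (0 < k)%N ->
  eqX n.+1 ((\sum_(e < n.+1) 'X^(k * e)) * (1 - 'X^k)) 1.
Proof.
move=> k0; under eq_bigr => e _ do rewrite exprM.
rewrite mulrC -opprB mulNr -subrX1 opprB -exprM.
by apply: eqX_1subXn; rewrite leq_pmull.
Qed.

(** A multiple of l contributes the single term e = 0, hence 1; any other part contributes a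
    truncated geometric series, inverse to 1 - X^(i+1). *)
Lemma eqX_regular (l n : nat) :
  eqX n.+1 ((\prod_(i < n) \sum_(e < n.+1 | (l %| i.+1)%N ==> (e == 0 :> nat))
      'X^(i.+1 * e)) * \prod_(i < n | ~~ (l %| i.+1)%N) (1 - 'X^(i.+1))) 1.
Proof.
rewrite [X in _ * X]big_mkcond -big_split /=.
rewrite -[X in eqX _ _ X](_ : \prod_(i < n) 1 = 1); last by rewrite big1.
apply: eqX_prod => i _; case: (l %| i.+1)%N => /=; last exact: eqX_geometric.
by rewrite (big_pred1 ord0) //= muln0 mulr1 eqX_refl.
Qed.

End CongruenceModXn.

(** * The generating function of b_4 over F_2 *)

Section ParityOfB4.
Local Open Scope ring_scope.

Lemma char2_poly (p : {poly 'F_2}) : p + p = 0.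
Proof. by rewrite -mulr2n -mulr_natl -polyC_natr pchar_Zp // mul0r. Qed.

Lemma b4_nontriangular n :
  (forall k, n <> 'C(k.+1, 2)) -> (b 4 n %% 2 = 0)%N.
Proof.
move=> nT; rewrite b_card.
have oppF (p : {poly 'F_2}) : - p = p.
  by apply/eqP; rewrite -subr_eq0 -opprD char2_poly oppr0.
(* Frobenius in F_2[X]; applied twice it turns E^4 into the product of the 1 - X^(4k). *)
have sq1 k : (1 - 'X^k) ^+ 2 = 1 - 'X^(2 * k) :> {poly 'F_2}.
  rewrite mulnC exprM sqrrB expr1n mul1r mulr2n char2_poly subr0 -exprM.
  by rewrite oppF.
have E4 : eqX n.+1 (qfact _ n ^+ 4)
    (\prod_(i < n | (4 %| i.+1)%N) (1 - 'X^(i.+1)) : {poly 'F_2}).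
  rewrite -prodrXl; under eq_bigr => i _ do rewrite (exprM _ 2 2) !sq1 mulnA.
  exact: eqX_prod_dvd.
have E3 : eqX n.+1 (qfact _ n ^+ 3) (\sum_(j < n.+1) 'X^'C(j.+1, 2) : {poly 'F_2}).
  (* Signs vanish in characteristic 2, so the product side of Gauss's identity is E^3. *)
  rewrite (_ : _ ^+ 3 = qfact _ n * \prod_(i < n) (1 + 'X^(i.+1)) ^+ 2).
    exact: eqX_gauss_triangular.
  by rewrite prodrXl exprS; congr (_ * _ ^+ 2); apply: eq_bigr => i _; rewrite oppF.
have := eqX_regular 'F_2 4 n; have := coef_mult_set 'F_2 4 n.
set P := \prod_(i < n) _; set A := \prod_(i < n | _) _ => cP PA.
have EA : qfact _ n = A * \prod_(i < n | (4 %| i.+1)%N) (1 - 'X^(i.+1)) :> {poly 'F_2}.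
  by rewrite /qfact (bigID (fun i : 'I_n => (4 %| i.+1)%N)) mulrC.
have PE : eqX n.+1 P (\sum_(j < n.+1) 'X^'C(j.+1, 2)).
  (* With E = [qfact _ n], it suffices to compare E P with E^4. Since E is [A] times the factors at
     multiples of 4 and P A is congruent to 1, E P reduces to those factors, that is, to E^4. *)
  apply: eqX_trans _ E3; apply: (@eqX_qfactI _ _ n); rewrite -exprS.
  apply: eqX_trans _ (eqX_sym E4); rewrite mulrC {1}EA mulrA.
  by rewrite -[X in eqX _ _ X]mul1r; apply: eqX_mul; rewrite ?eqX_refl.
(* No exponent C(j+1,2) equals n, so the coefficient of X^n, which is b_4(n) in F_2, is zero. *)
have := eqX_coef PE (ltnSn n); rewrite cP coef_sum big1 => [|j _].
  by move/eqP; rewrite -(dvdn_pcharf (pchar_Fp _)) // => /eqP.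
by rewrite coefXn; case: eqP => // /nT.
Qed.

End ParityOfB4.

(** * Squares and residues *)

Lemma triangular_square k : 8 * 'C(k.+1, 2) + 1 = (2 * k + 1) ^ 2.
Proof.
have : 2 * 'C(k.+1, 2) = k.+1 * k.
  rewrite bin2 /= mul2n -[RHS]odd_double_half oddM oddS.
  by case: (odd k).
nia.
Qed.

Lemma legendre_square a p u :
  0 < p -> u ^ 2 = a %[mod p] -> legendre a p <> (-1)%Z.
Proof.
move=> p0 Eu; rewrite /legendre; case: ifP => // _.
(* The definition ranges over residues below p, so the witness is u reduced modulo p. *)
case: ifP => // /existsP[]; exists (Ordinal (ltn_pmod u p0)) => /=.
by rewrite modnMm mulnn Eu.
Qed.

Lemma not_triangular (p alpha n j k : nat) :
  prime p -> odd p -> legendre (8 * j + 1) p = (-1)%Z ->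
  p ^ (2 * alpha + 1) * n + ((8 * j + 1) * p ^ (2 * alpha) - 1) %/ 8
  <> 'C(k.+1, 2).
Proof.
move=> pp op leg E; have p0 := prime_gt0 pp.
have E8 : (2 * k + 1) ^ 2 = p ^ (2 * alpha) * (8 * p * n + (8 * j + 1)).
  rewrite -triangular_square -E expnD expn1.
  have -> : p ^ (2 * alpha) = (p ^ alpha) ^ 2 by rewrite mulnC expnM.
  have : odd (p ^ alpha) by rewrite oddX op orbT.
  set q := p ^ alpha => oq.
  (* An odd square is 1 modulo 8, which makes the division by 8 in the statement exact. *)
  have : 8 %| q ^ 2 - 1.
    have -> : q = 2 * q./2 + 1 by rewrite -[LHS]odd_double_half oq; lia.
    by rewrite -triangular_square addnK dvdn_mulr.
  case/dvdnP => c Ec.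
  have Eq : q ^ 2 = 8 * c + 1 by have := odd_gt0 oq; nia.
  rewrite Eq.
  have -> : (8 * j + 1) * (8 * c + 1) - 1 = 8 * (8 * j * c + j + c) by lia.
  by rewrite mulKn //; nia.
(* As p^(2 alpha) divides (2k+1)^2, p^alpha divides 2k+1; the quotient u is a square root of 8j+1
   modulo p. *)
have [u Eu] : exists u, 2 * k + 1 = u * p ^ alpha.
  by apply/dvdnP; rewrite -(@dvdn_pexp2r _ _ 2) // E8 -expnM mulnC dvdn_mulr.
refine (@legendre_square (8 * j + 1) p u p0 _ leg).
have : u ^ 2 = 8 * p * n + (8 * j + 1).
  apply/eqP; rewrite -(eqn_pmul2l (m := p ^ (2 * alpha))) ?expn_gt0 ?p0 //.
  by rewrite -E8 Eu expnMn -expnM [alpha * 2]mulnC mulnC.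
have -> : 8 * p * n = 8 * n * p by lia.
by move->; rewrite modnMDl.
Qed.

Theorem theorem3p11 (p alpha n j : nat) :
  prime p -> odd p -> j <= p - 1 -> legendre (8 * j + 1) p = (-1)%Z ->
  b 4 (p ^ (2 * alpha + 1) * n + ((8 * j + 1) * p ^ (2 * alpha) - 1) %/ 8) %% 2 = 0.
Proof.
move=> pp op _ leg; apply: b4_nontriangular => k.
exact: not_triangular.
Qed.
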